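(* Let $F:\mathbb{R}^d\to\mathbb{R}^d$ be a real analytic vector field that admits a non-constant global analytic first integral, i.e. a non-constant real analytic function $G:\mathbb{R}^d\to\mathbb{R}$ with $\nabla G(u)\cdot F(u)=0$ for all $u\in\mathbb{R}^d$. Then no trajectory of $F$ is a set of uniqueness for analytic functions, and thus $F$ is not analytically discoverable.
   Context: A trajectory of $F$ is the image of a solution $u$ of $\dot u=F(u)$ on an interval. A set $A\subseteq\mathbb{R}^d$ is a set of uniqueness for analytic functions if every real analytic $K:\mathbb{R}^d\to\mathbb{R}^d$ vanishing on $A$ is identically zero. $F$ is analytically discoverable if there exist an open interval $U\subseteq\mathbb{R}$ and a solution $u:U\to\mathbb{R}^d$ of $\dot u=F(u)$ such that $F$ is the only real analytic $K:\mathbb{R}^d\to\mathbb{R}^d$ with $\dot u=K(u)$ on $U$. *)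

(* Defs.v *)
From HB Require Import structures.
From mathcomp Require Import all_boot all_order all_algebra.
From mathcomp Require Import all_classical all_reals all_analysis.
From mathcomp.analysis.showcase Require Import summability.

Set Implicit Arguments.
Unset Strict Implicit.
Unset Printing Implicit Defensive.

Import Order.TTheory GRing.Theory Num.Theory.
Import numFieldNormedType.Exports.

Local Open Scope classical_set_scope.
Local Open Scope ring_scope.

(* The value of the monomial of multi-index a at h. *)
Definition monomial (R : realType) (d : nat) (a : {ffun 'I_d -> nat})
    (h : 'rV[R]_d) : R :=
  \prod_(i < d) h 0 i ^+ a i.

(* Near x, f is the sum of a multi-index power series centred at x. The sum is
   unconditional (limit of the finite partial sums along the directed set of
   finite sets of multi-indices), so no enumeration of the multi-indices is
   chosen; in finite dimension this is absolute convergence. *)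
Definition analytic_at (R : realType) (d : nat) (V : normedModType R)
    (f : 'rV[R]_d -> V) (x : 'rV[R]_d) : Prop :=
  exists c : {ffun 'I_d -> nat} -> V,
    \forall y \near x,
      partial_sum (fun a => monomial a (y - x) *: c a) @ totally --> f y.

Definition real_analytic (R : realType) (d : nat) (V : normedModType R)
    (f : 'rV[R]_d -> V) : Prop :=
  forall x, analytic_at f x.

Definition nonconstant (T U : Type) (g : T -> U) : Prop :=
  ~ exists c, forall x, g x = c.

Definition partial (R : realType) (d : nat) (G : 'rV[R]_d -> R) (i : 'I_d)
    (x : 'rV[R]_d) : R :=
  'D_(delta_mx 0 i) G x.

Definition analytic_first_integral (R : realType) (d : nat)
    (F : 'rV[R]_d -> 'rV[R]_d) (G : 'rV[R]_d -> R) : Prop :=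
  real_analytic G /\ forall x, \sum_(i < d) partial G i x * F x 0 i = 0.

(* The derivative is taken within J, so it is one-sided at an endpoint of J
   that belongs to J. Only the values of u on J matter. *)
Definition solution_on (R : realType) (d : nat) (F : 'rV[R]_d -> 'rV[R]_d)
    (J : set R) (u : R -> 'rV[R]_d) : Prop :=
  forall t, J t ->
    (s - t)^-1 *: (u s - u t) @[s --> within J t^'] --> F (u t).

Lemma solution_on_openP (R : realType) (d : nat) (F : 'rV[R]_d -> 'rV[R]_d)
    (J : set R) (u : R -> 'rV[R]_d) : open J ->
  solution_on F J u <-> forall t, J t -> is_derive t 1 u (F (u t)).
Proof.
move=> oJ.
have dnbhsJ t : J t -> within J t^' = t^'.
  move=> Jt; apply/seteqP; split=> P; last exact: cvg_within.
  rewrite /within/= => PJ; have : \forall s \near t^', J s.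
    by apply: (@cvg_within _ (nbhs t)); exact: open_nbhs_nbhs.
  by move: PJ; apply: filterS2 => s /[apply].
have slopeE t : (s - t)^-1 *: (u s - u t) @[s --> t^'] =
    h^-1 *: ((u \o shift t) (h *: (1 : R)) - u t) @[h --> (0 : R)^'].
  set q := fun s : R => (s - t)^-1 *: (u s - u t).
  suff -> : t^' = (h + t) @[h --> (0 : R)^'].
    apply: (congr1 (fun g => g @ (0 : R)^')); apply/funext => h /=.
    by rewrite /q addrK [h%:A]mulr1.
  apply/predeqP => P; apply: (iff_trans (nbhs0P (fun s => s != t -> P s) t)).
  rewrite /= /dnbhs /within/=.
  split; apply: (@filterS _ (nbhs (0 : R))) => h /=;
    by rewrite (addrC t h) -(subr_eq0 (h + t)) addrK.
split=> [uF t Jt|uF t Jt].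
  have := uF t Jt; rewrite dnbhsJ// slopeE => uFt; split.
    by apply/cvg_ex; exists (F (u t)).
  exact: cvg_lim uFt.
rewrite dnbhsJ// slopeE; have [/cvg_ex[l ul] <-] := uF t Jt.
by rewrite /derive (cvg_lim _ ul).
Qed.

(* An interval containing at least two points; it may be bounded or unbounded,
   and may or may not contain its endpoints. *)
Definition proper_interval (R : realType) (J : set R) : Prop :=
  is_interval J /\ exists s t, [/\ J s, J t & s < t].

Definition trajectory (R : realType) (d : nat) (F : 'rV[R]_d -> 'rV[R]_d)
    (A : set 'rV[R]_d) : Prop :=
  exists (J : set R) (u : R -> 'rV[R]_d),
    [/\ proper_interval J, solution_on F J u & A = u @` J].

Definition set_of_uniqueness (R : realType) (d : nat) (A : set 'rV[R]_d)
    : Prop :=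
  forall K : 'rV[R]_d -> 'rV[R]_d, real_analytic K ->
    (forall x, A x -> K x = 0) -> forall x, K x = 0.

Definition analytically_discoverable (R : realType) (d : nat)
    (F : 'rV[R]_d -> 'rV[R]_d) : Prop :=
  exists (U : set R) (u : R -> 'rV[R]_d),
    [/\ open U, proper_interval U, solution_on F U u &
      unique (fun K : 'rV[R]_d -> 'rV[R]_d =>
        real_analytic K /\ solution_on K U u) F].

(* Main.v *)
Require Import Defs.
From mathcomp Require Import all_boot all_order all_algebra finmap.
From mathcomp Require Import all_classical all_reals all_analysis.
From mathcomp.analysis.showcase Require Import summability.

Set Implicit Arguments.
Unset Strict Implicit.
Unset Printing Implicit Defensive.

Import Order.TTheory GRing.Theory Num.Theory.
Import numFieldNormedType.Exports.

Local Open Scope classical_set_scope.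
Local Open Scope ring_scope.

(** A first integral [G] is constant along a solution [u], because the chain
    rule gives [(G \o u)' = grad G (u) . F (u) = 0]. Let [k] be that constant
    and let [x] be a point with [G x != k], which exists since [G] is not
    constant. Then [K y := (G y - k) *: (x - u t0)] is analytic, vanishes on the
    trajectory, and does not vanish at [x]: the vector [x - u t0] is nonzero
    because [G] separates [x] from [u t0]. So the trajectory is not a set of
    uniqueness ([analytic_vanishing_on_solution]). Moreover [F + K] is another
    analytic field with solution [u], so no solution determines [F].

    The analytic content is the chain rule, that is, that a function which has
    a power series expansion at a point is differentiable there
    ([analytic_differentiable]). An unconditionally convergent family of reals
    is absolutely summable ([bounded_sum_norm]). Applied at
    [x + const_mx r] for a small [r > 0], this bounds the finite sums of
    [`|c a| * r ^+ mdegree a]. Hence all but finitely many terms of the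
    series sum to [O(`|h| ^+ 2)] ([analytic_remainder]), and [G] is a
    polynomial plus a quadratically small remainder.

    A solution is only one-sidedly differentiable at an endpoint of its
    interval that belongs to it. There, continuity of [u] within the interval
    is enough: on a segment, the mean value theorem asks for the derivative in
    the interior only. *)

(** * Unconditional summation over finite sets of indices *)

#[local] Existing Instance totally_filter.

Lemma partial_sumE (I : choiceType) (V : zmodType) (f : I -> V)
    (A : {fset I}) : partial_sum f A = \sum_(i <- A) f i.
Proof. by rewrite /partial_sum big_seq_fsetE. Qed.

Lemma near_totally (I : choiceType) (A : {fset I}) :
  \forall B \near totally, (A `<=` B)%fset.
Proof. by exists A. Qed.

Lemma big_fsetID_sub (I : choiceType) (V : zmodType) (f : I -> V)
    (A B : {fset I}) : (A `<=` B)%fset ->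
  \sum_(i <- B) f i = \sum_(i <- A) f i + \sum_(i <- (B `\` A)%fset) f i.
Proof.
move=> AB; rewrite (big_fsetID _ [in A])/=; congr (_ + _).
  have -> // : [fset x in B | x \in A]%fset = A.
  apply/fsetP => i; rewrite !inE/= andbC.
  by case: (boolP (i \in A)) => //= /(fsubsetP AB).
have -> // : [fset x in B | x \notin A]%fset = (B `\` A)%fset.
by apply/fsetP => i; rewrite !inE/= andbC.
Qed.

(** Beyond some finite set [A] the partial sums stay within [1] of the limit;
    removing from [A `|` B] its part outside [B] changes the sum by at most the
    absolute sum over [A]. So all partial sums are bounded by one constant [C],
    and splitting [B] by the sign of [f] bounds the absolute sums by [C + C]. *)
Lemma bounded_sum_norm (I : choiceType) (R : realType) (f : I -> R) (l : R) :
  partial_sum f @ totally --> l ->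
  exists M, forall B : {fset I}, \sum_(i <- B) `|f i| <= M.
Proof.
move=> /cvgrPdist_lt/(_ 1 ltr01)[A _ Al].
set C := `|l| + 1 + \sum_(i <- A) `|f i|.
have boundC (B : {fset I}) : `|\sum_(i <- B) f i| <= C.
  have /Al : (A `<=` (A `|` B))%fset by exact: fsubsetUl.
  rewrite partial_sumE (@big_fsetID_sub _ _ _ B); last exact: fsubsetUr.
  set s := \sum_(i <- B) _; set r := \sum_(i <- _) _ => lsr.
  have rA : `|r| <= \sum_(i <- A) `|f i|.
    apply: le_trans (ler_norm_sum _ _ _) _.
    rewrite [leRHS](@big_fsetID_sub _ _ _ ((A `|` B) `\` B)%fset).
      by rewrite lerDl sumr_ge0.
    by apply/fsubsetP => i; rewrite !inE => /andP[/negPf->]; rewrite orbF.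
  have -> : s = l - (l - (s + r)) - r by rewrite opprB addrCA subrr addr0 addrK.
  apply: le_trans (ler_normB _ _) _; apply: lerD => //.
  by apply: le_trans (ler_normB _ _) _; rewrite lerD2l ltW.
exists (C + C) => B.
rewrite (big_fsetID _ (fun i => 0 <= f i))/=; apply: lerD.
  rewrite big_seq (eq_bigr f) => [|i]; last first.
    by rewrite !inE/= => /andP[_ fi]; rewrite ger0_norm.
  by rewrite -big_seq; apply: le_trans (boundC _); exact: ler_norm.
rewrite big_seq (eq_bigr (fun i => - f i)) => [|i]; last first.
  by rewrite !inE/= => /andP[_]; rewrite -ltNge => fi; rewrite ltr0_norm.
by rewrite -big_seq sumrN; apply: le_trans (ler_norm _) _; rewrite normrN.
Qed.

Lemma ler_dist_partial_sum (I : choiceType) (R : realType) (f : I -> R)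
    (l w M : R) (A : {fset I}) : partial_sum f @ totally --> l ->
  (forall B : {fset I}, (A `<=` B)%fset -> `|w - \sum_(i <- B) f i| <= M) ->
  `|w - l| <= M.
Proof.
move=> fl wM; have wfl : `|w - partial_sum f B| @[B --> totally] --> `|w - l|.
  by apply: cvg_norm; apply: cvgB => //; exact: cvg_cst.
apply: (cvgr_to_le wfl); near=> B; rewrite partial_sumE; apply: wM.
by near: B; exact: near_totally.
Unshelve. all: by end_near. Qed.

(** * Multi-index monomials *)

Lemma ler_norm_coord (R : realType) (m n : nat) (h : 'M[R]_(m, n)) i j :
  `|h i j| <= `|h|.
Proof.
rewrite [leRHS]/Num.norm /= mx_normrE; apply/bigmax_geP; right => /=.
by exists (i, j).
Qed.

Definition mdegree (d : nat) (a : {ffun 'I_d -> nat}) : nat :=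
  (\sum_(i < d) a i)%N.

Lemma monomial_const (R : realType) (d : nat) (a : {ffun 'I_d -> nat})
    (r : R) : monomial a (const_mx r : 'rV[R]_d) = r ^+ mdegree a.
Proof.
rewrite /monomial /mdegree; under eq_bigr do rewrite mxE.
by rewrite prodrXr.
Qed.

Lemma ler_norm_monomial (R : realType) (d : nat) (a : {ffun 'I_d -> nat})
    (h : 'rV[R]_d) : `|monomial a h| <= `|h| ^+ mdegree a.
Proof.
rewrite -monomial_const /monomial normr_prod; apply: ler_prod => i _.
by rewrite normrX mxE exprn_ge0//= lerXn2r ?nnegrE// ler_norm_coord.
Qed.

Lemma differentiable_monomial (R : realType) (d : nat)
    (a : {ffun 'I_d -> nat}) (h : 'rV[R]_d) : differentiable (monomial a) h.
Proof.
rewrite (_ : monomial a = \prod_(i < d) (fun k : 'rV[R]_d => k 0 i : R) ^+ a i).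
  elim/big_ind : _ => [||i _].
  - exact: differentiable_cst.
  - by move=> f g df dg; exact: differentiableM.
  - case: (a i) => [|n]; first exact: differentiable_cst.
    by apply: differentiableX; exact: differentiable_coord.
apply/funext => k; rewrite /monomial fct_prodE; apply: eq_bigr => i _.
by rewrite exprfctE.
Qed.

(** * Analytic functions are differentiable *)

(** The differential of [g] at [x] is zero. *)
Lemma differentiable_quadratic (R : realType) (V W : normedModType R)
    (g : V -> W) (x : V) (C : R) : g x = 0 ->
  (\forall h \near 0, `|g (h + x)| <= C * `|h| ^+ 2) -> differentiable g x.
Proof.
move=> gx0 gC.
have c0 : continuous (\0 : V -> W) by move=> y; exact: cvg_cst.
have gE : g \o shift x = cst (g x) + (\0 : V -> W) +o_ 0 id.
  apply/eqaddoP => e e0; near=> h.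
  rewrite /= gx0 !fctE /= /cst add0r subr0.
  have hC : `|g (h + x)| <= C * `|h| ^+ 2 by near: h.
  apply: le_trans hC _; rewrite expr2 mulrA ler_wpM2r//.
  have C1 : 0 < `|C| + 1 by rewrite ltr_wpDl.
  apply: (@le_trans _ _ ((`|C| + 1) * `|h|)).
    by rewrite ler_wpM2r// (le_trans (ler_norm _))// lerDl.
  by rewrite -ler_pdivlMl// mulrC; near: h; apply: nbhs0_le; exact: divr_gt0.
by apply/diff_locallyP; rewrite (diff_unique c0 gE).
Unshelve. all: by end_near. Qed.

(** A finite set of multi-indices that contains all those of degree at most
    one. The monomials left out have degree at least two, and those kept form
    a polynomial, so degree-one monomials need not be singled out. *)
Definition squarefree_indices (d : nat) : {fset {ffun 'I_d -> nat}} :=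
  [fset [ffun i => val (f i)] | f : {ffun 'I_d -> 'I_2} in predT]%fset.

Lemma mdegree_gt1 (d : nat) (a : {ffun 'I_d -> nat}) :
  a \notin squarefree_indices d -> (1 < mdegree a)%N.
Proof.
apply: contraNT; rewrite -leqNgt => a1.
have ai i : (a i < 2)%N.
  by rewrite ltnS; apply: leq_trans a1; rewrite /mdegree (bigD1 i)//= leq_addr.
apply/imfsetP; exists [ffun i => Ordinal (ai i)] => //=.
by apply/ffunP => i; rewrite !ffunE.
Qed.

(** Choose [r > 0] such that the series converges at [x + const_mx r]. When
    [`|h| <= r], a monomial of degree at least two takes at [h] a value of
    absolute value at most [(`|h| / r) ^+ 2] times its value at [const_mx r],
    where the absolute sums of the series are bounded. *)
Lemma analytic_remainder (R : realType) (d : nat) (G : 'rV[R]_d -> R)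
    (x : 'rV[R]_d) (c : {ffun 'I_d -> nat} -> R) :
  (\forall y \near x,
    partial_sum (fun a => monomial a (y - x) *: c a) @ totally --> G y) ->
  exists C, \forall h \near (0 : 'rV[R]_d),
    `|G (h + x) - \sum_(a <- squarefree_indices d) monomial a h * c a|
      <= C * `|h| ^+ 2.
Proof.
move=> /nbhs_ballP[e /= e0 eG].
pose r := e / 2.
have r0 : 0 < r by rewrite divr_gt0.
have rX0 n : 0 <= r ^+ n by rewrite exprn_ge0// ltW.
have sumG (h : 'rV[R]_d) : `|h| < e ->
    partial_sum (fun a => monomial a h * c a) @ totally --> G (h + x).
  move=> he; have /eG : ball x e (h + x).
    by rewrite -ball_normE /= opprD addrCA subrr addr0 normrN.
  by rewrite addrK.
have : `|const_mx r : 'rV[R]_d| < e.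
  rewrite /Num.norm /= mx_normrE; apply/bigmax_ltP; split=> // i _.
  by rewrite mxE gtr0_norm// ltr_pdivrMr// ltr_pMr// ltr1n.
move=> /sumG/bounded_sum_norm[M boundM].
exists (M / r ^+ 2); near=> h.
have hr : `|h| <= r by near: h; apply: (@nbhs0_le R 'rV[R]_d).
rewrite distrC.
apply: (@ler_dist_partial_sum _ _ _ _ _ _ (squarefree_indices d) (sumG h _)).
  by apply: le_lt_trans hr _; rewrite ltr_pdivrMr// ltr_pMr// ltr1n.
move=> B tB; rewrite (big_fsetID_sub _ tB) opprD addrA subrr sub0r normrN.
apply: le_trans (ler_norm_sum _ _ _) _.
apply: (@le_trans _ _ (\sum_(a <- (B `\` squarefree_indices d)%fset)
    `|monomial a (const_mx r : 'rV[R]_d) * c a| * (`|h| / r) ^+ 2)).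
  rewrite big_seq [leRHS]big_seq; apply: ler_sum => a.
  rewrite inE => /andP[/mdegree_gt1 a2 _].
  rewrite !normrM mulrAC ler_wpM2r//.
  apply: le_trans (ler_norm_monomial _ _) _.
  rewrite monomial_const ger0_norm//.
  rewrite -[in leLHS](divfK (lt0r_neq0 r0) `|h|) exprMn mulrC ler_wpM2l//.
  rewrite ler_wiXn2l//; first by rewrite divr_ge0// ltW.
  by rewrite ler_pdivrMr// mul1r.
rewrite -mulr_suml expr_div_n mulrA mulrAC ler_wpM2r ?exprn_ge0//.
by rewrite ler_wpM2r// invr_ge0.
Unshelve. all: by end_near. Qed.

(** [G] is the polynomial of square-free terms plus a remainder that is
    [O(`|y - x| ^+ 2)]; this bound at [y = x] also makes the remainder vanish
    there. *)
Lemma analytic_differentiable (R : realType) (d : nat) (G : 'rV[R]_d -> R)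
    (x : 'rV[R]_d) : analytic_at G x -> differentiable G x.
Proof.
move=> [c /analytic_remainder[C GC]].
pose P (h : 'rV[R]_d) : R :=
  \sum_(a <- squarefree_indices d) monomial a h * c a.
have dP h : differentiable P h.
  rewrite (_ : P = \sum_(a <- squarefree_indices d) (monomial a * cst (c a))).
    elim/big_ind : _ => [|f g df dg|a _].
    - exact: differentiable_cst.
    - exact: differentiableD.
    - by apply: differentiableM => //; exact: differentiable_monomial.
  by apply/funext => k; rewrite fct_sumE.
have dshift : differentiable (P \o center x) x.
  by apply: differentiable_comp.
pose g y := G y - P (y - x).
rewrite (_ : G = g + (P \o center x)); last first.
  by apply/funext => y; rewrite !fctE /= /g subrK.
apply: differentiableD => //.
apply: (@differentiable_quadratic _ _ _ _ _ C).
  have := nbhs_singleton GC; rewrite add0r normr0 expr0n mulr0 normr_le0.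
  by rewrite /g subrr => /eqP.
by near=> h; rewrite /g addrK; near: h.
Unshelve. all: by end_near. Qed.

(** * First integrals are constant along solutions *)

Lemma solution_on_subset (R : realType) (d : nat) (F : 'rV[R]_d -> 'rV[R]_d)
    (I J : set R) (u : R -> 'rV[R]_d) : I `<=` J ->
  solution_on F J u -> solution_on F I u.
Proof.
move=> IJ uF t It; apply: cvg_trans (uF t (IJ _ It)).
by apply: cvg_app; exact: within_subset.
Qed.

(** Continuity at the endpoints of [J] too, where [u] has no two-sided
    derivative. *)
Lemma solution_on_continuous (R : realType) (d : nat)
    (F : 'rV[R]_d -> 'rV[R]_d) (J : set R) (u : R -> 'rV[R]_d) :
  solution_on F J u -> {within J, continuous u}.
Proof.
move=> uF; apply/subspace_continuousP => t Jt.
have uFt := uF t Jt.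
(* Away from t the increment of u is s - t times a convergent slope. *)
have ut0 : (s - t) *: ((s - t)^-1 *: (u s - u t)) @[s --> within J t^'] -->
    (0 : 'rV[R]_d).
  rewrite -(scale0r (F (u t))); apply: cvgZ => //.
  rewrite -(subrr t); apply: cvgB; last exact: cvg_cst.
  apply: cvg_trans (@cvg_within _ (nbhs t) _ (fun s => s != t)).
  exact: cvg_within.
apply/cvgrPdistC_lt => e e0.
move/cvgr0Pnorm_lt/(_ e e0) : ut0 => ute.
move: ute; rewrite /dnbhs /within /=; apply: (@filterS _ (nbhs t)) => s ust Js.
have [->|st] := eqVneq s t; first by rewrite subrr normr0.
by have := ust st Js; rewrite scalerA divff ?subr_eq0// scale1r.
Qed.

Lemma first_integral_derive (R : realType) (d : nat)
    (F : 'rV[R]_d -> 'rV[R]_d) (G : 'rV[R]_d -> R) (u : R -> 'rV[R]_d)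
    (t : R) :
  analytic_first_integral F G -> is_derive t 1 u (F (u t)) ->
  is_derive t 1 (G \o u) 0.
Proof.
move=> [/(_ (u t))/analytic_differentiable dG GF] [du uF].
have du' : differentiable u t by exact/derivable1_diffP.
have dGu : differentiable (G \o u) t by exact: differentiable_comp.
split; first exact/derivable1_diffP.
rewrite deriveE// diff_comp//= -(deriveE _ du') uF.
rewrite [X in 'd G (u t) X]row_sum_delta linear_sum /= -[RHS](GF (u t)).
by apply: eq_bigr => i _; rewrite linearZ /= /partial deriveE// mulrC.
Qed.

Lemma first_integral_constant (R : realType) (d : nat)
    (F : 'rV[R]_d -> 'rV[R]_d) (G : 'rV[R]_d -> R) (J : set R)
    (u : R -> 'rV[R]_d) (s t : R) :
  analytic_first_integral F G -> is_interval J -> solution_on F J u ->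
  J s -> J t -> G (u s) = G (u t).
Proof.
move=> FG Jitv uF; wlog st : s t / s < t => [wlg|] Js Jt.
  by have [/wlg->//|/wlg->//|->] := ltgtP s t.
have stJ : `[s, t] `<=` J by move=> r; rewrite /= in_itv/=; exact: Jitv.
have sub : `]s, t[ `<=` J.
  by apply: subset_trans stJ; exact: subset_itv_oo_cc.
have Gu' r : r \in `]s, t[ -> is_derive r 1 (G \o u) 0.
  move=> rst; apply: first_integral_derive FG _.
  have /solution_on_openP := solution_on_subset sub uF.
  by apply => //; exact: itv_open.
have Gucont : {within `[s, t], continuous (G \o u)}.
  apply/subspace_continuousP => r rst.
  have /subspace_continuousP/(_ r rst) ur :=
    solution_on_continuous (solution_on_subset stJ uF).
  apply: cvg_comp ur _.
  exact: (differentiable_continuous (analytic_differentiable (FG.1 (u r)))).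
have [r _] := MVT st Gu' Gucont.
by rewrite mul0r => /eqP; rewrite subr_eq0 => /eqP.
Qed.

(** * Operations on analytic functions *)

Lemma analytic_atD (R : realType) (d : nat) (V : normedModType R)
    (f g : 'rV[R]_d -> V) (x : 'rV[R]_d) :
  analytic_at f x -> analytic_at g x -> analytic_at (f \+ g) x.
Proof.
move=> [a fa] [b gb]; exists (a \+ b); near=> y.
have fay : partial_sum (fun i => monomial i (y - x) *: a i) @ totally --> f y.
  by near: y.
have gby : partial_sum (fun i => monomial i (y - x) *: b i) @ totally --> g y.
  by near: y.
apply: cvg_trans (cvgD fay gby); apply: near_eq_cvg; near=> A.
rewrite /= !fctE !partial_sumE -big_split /=.
by apply: eq_bigr => i _; rewrite scalerDr.
Unshelve. all: by end_near. Qed.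

Lemma analytic_at_cst (R : realType) (d : nat) (V : normedModType R)
    (v : V) (x : 'rV[R]_d) : analytic_at (cst v) x.
Proof.
pose z : {ffun 'I_d -> nat} := [ffun=> 0%N].
exists (fun a => if a == z then v else 0); near=> y.
apply: cvg_near_cst; near=> A; have zA : z \in A.
  have /fsubsetP : ([fset z] `<=` A)%fset by near: A; exact: near_totally.
  by apply; rewrite inE.
rewrite partial_sumE (big_fsetD1 z)//= eqxx /monomial.
rewrite big1 ?scale1r => [|i _]; last by rewrite ffunE expr0.
rewrite big_seq big1 ?addr0// => a; rewrite !inE => /andP[/negPf-> _].
exact: scaler0.
Unshelve. all: by end_near. Qed.

Lemma analytic_atZl (R : realType) (d : nat) (V : normedModType R)
    (f : 'rV[R]_d -> R) (v : V) (x : 'rV[R]_d) :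
  analytic_at f x -> analytic_at (fun y => f y *: v) x.
Proof.
move=> [a fa]; exists (fun i => a i *: v); near=> y.
have fay : partial_sum (fun i => monomial i (y - x) *: a i) @ totally --> f y.
  by near: y.
apply: cvg_trans (cvgZr_tmp fay); apply: near_eq_cvg; near=> A.
rewrite /= !partial_sumE scaler_suml.
by apply: eq_bigr => i _; rewrite scalerA.
Unshelve. all: by end_near. Qed.

(** * An analytic field that vanishes on the trajectory *)

(** Both halves of the theorem use this field: it shows directly that the
    trajectory is not a set of uniqueness, and adding it to [F] leaves [u] a
    solution. *)
Lemma analytic_vanishing_on_solution (R : realType) (d : nat)
    (F : 'rV[R]_d -> 'rV[R]_d) (G : 'rV[R]_d -> R) (J : set R)
    (u : R -> 'rV[R]_d) :
  nonconstant G -> analytic_first_integral F G -> proper_interval J ->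
  solution_on F J u ->
  exists K : 'rV[R]_d -> 'rV[R]_d, [/\ real_analytic K,
    forall t, J t -> K (u t) = 0 & exists x, K x != 0].
Proof.
move=> Gnc FG [Jitv [t0 [_ [Jt0 _ _]]]] uF.
have [x Gx] : exists x, G x != G (u t0).
  apply: contrapT => nG; apply: Gnc; exists (G (u t0)) => x.
  by apply/eqP; apply: contrapT => /negP Gx; apply: nG; exists x.
exists (fun y => (G y - G (u t0)) *: (x - u t0)); split.
- move=> y; apply/analytic_atZl.
  apply: (@analytic_atD _ _ _ G (cst (- G (u t0)))); first exact: FG.1.
  exact: analytic_at_cst.
- move=> t Jt; rewrite (first_integral_constant FG Jitv uF Jt Jt0).
  by rewrite subrr scale0r.
- exists x; rewrite scaler_eq0 !subr_eq0 (negPf Gx)/=.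
  by apply: contraNN Gx => /eqP->.
Qed.

Theorem theorem6p1 (R : realType) (d : nat) (F : 'rV[R]_d -> 'rV[R]_d)
    (F_analytic : real_analytic F)
    (first_integral : exists G : 'rV[R]_d -> R,
      nonconstant G /\ analytic_first_integral F G) :
  (forall A : set 'rV[R]_d, trajectory F A -> ~ set_of_uniqueness A) /\
  ~ analytically_discoverable F.
Proof.
have [G [Gnc FG]] := first_integral; split.
  move=> _ [J [u [Jitv uF ->]]] uniqA.
  have [K [Kan Ku0 [x Kx]]] := analytic_vanishing_on_solution Gnc FG Jitv uF.
  case/eqP : Kx; apply: uniqA => // _ [t Jt <-].
  exact: Ku0.
move=> [U [u [_ Uitv uF [_ Funiq]]]].
have [K [Kan Ku0 [x Kx]]] := analytic_vanishing_on_solution Gnc FG Uitv uF.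
have FK : F = F \+ K.
  apply: Funiq; split=> [y|t Ut]; first exact: analytic_atD.
  by rewrite /= Ku0// addr0; exact: uF.
case/eqP : Kx; apply: (@addrI _ (F x)).
by rewrite addr0; exact/esym/(congr1 (@^~ x) FK).
Qed.
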